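(* Let $K$ be a nonempty subset of a metric space $(X,d)$ and let $T, f, g: K \to K$ be three mappings which satisfy $\overline{T(K)} \subseteq f(K) \cap g(K)$. Assume that for all $x,y \in K$, \[ d(Tx,Ty) \leq \varphi\Big(\min\Big\{\max\big\{d(fx,gy),\, d(Tx,fx),\, d(Ty,gy),\, \tfrac{1}{2}[d(Tx,gy) + d(Ty,fx)]\big\},\ \max\big\{d(fy,gx),\, d(Tx,gx),\, d(Ty,fy),\, \tfrac{1}{2}[d(Tx,fy) + d(Ty,gx)]\big\}\Big\}\Big), \] where $\varphi: \mathbb{R}_{+} \to \mathbb{R}_{+}$ is upper semi-continuous on $\mathbb{R}_{+}$ and $0 \leq \varphi(t) < t$ for $t > 0$. If at least one of $\overline{T(K)}$, $f(K)$, $g(K)$ is complete, and the pairs of mappings $(T,f)$ and $(T,g)$ are weakly compatible, then $F(T) \cap F(f) \cap F(g)$ is a singleton.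
   Context: Notation: $\mathbb{R}_{+} = [0,\infty)$; $\overline{A}$ denotes the closure of a set $A$ in $X$; for a self-map $S$ of $K$, $F(S) = \{x \in K : Sx = x\}$ is its set of fixed points. Two self-maps $S, h$ of $K$ are called weakly compatible if they commute at their coincidence points: for every $x \in K$, if $hx = Sx$ then $hSx = Shx$. Completeness of a subset of $X$ means completeness with respect to the restricted metric $d$. *)

(* Defs.v *)
From HB Require Import structures.
From mathcomp Require Import all_boot all_order all_algebra.
From mathcomp Require Import all_classical reals topology.

Set Implicit Arguments.
Unset Strict Implicit.
Unset Printing Implicit Defensive.

Import Order.TTheory GRing.Theory Num.Theory.
Import numFieldTopology.Exports.

Local Open Scope classical_set_scope.
Local Open Scope ring_scope.

(* A self-map of a subset K of X is represented by a total function S : X -> X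
   with set_fun K K S; its values outside K are irrelevant. *)

Definition fixed_points (X : Type) (K : set X) (S : X -> X) : set X :=
  [set x | K x /\ S x = x].

Definition weakly_compatible (X : Type) (K : set X) (S h : X -> X) : Prop :=
  forall x, K x -> h x = S x -> h (S x) = S (h x).

(* Completeness of A for the restricted metric: a sequence in A is Cauchy for
   the restricted metric iff it is Cauchy in X, and its limit must lie in A. *)
Definition complete_subset (R : realType) (X : metricType R) (A : set X) :
    Prop :=
  forall u : nat -> X, (forall n, A (u n)) -> cauchy (u @ \oo) ->
    exists2 l, A l & u @ \oo --> l.

(* Upper semi-continuity of the restriction of f to A, for the subspace
   topology on A (cf. lower_semicontinuous in ereal_normedtype). *)
Definition upper_semicontinuous_on (R : realType) (T : topologicalType)
    (A : set T) (f : T -> R) : Prop :=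
  forall x a, A x -> f x < a -> \forall y \near within A (nbhs x), f y < a.

(* Main.v *)
(* Upper semicontinuity turns the contraction into a uniform gap: for each e > 0
   there is c > 0 such that d(Tx,Ty) <= e - c as soon as the first maximum
   (hence the minimum) is below e + c. A Jungck sequence with y_n = T x_n,
   f x_(n+1) = y_n for even n and g x_(n+1) = y_n for odd n then has steps
   decreasing to 0, and the gap propagates d(y_n, y_m) < e along indices of
   opposite parity, so y is Cauchy. As y lies in all three of T(K), f(K), g(K),
   any of the completeness hypotheses gives a limit l in the closure of T(K), so
   l = f u = g v. The gap yields T u = l = T v, weak compatibility then gives
   T l = f l = g l, and comparing T l with T v gives T l = l. *)
Require Import Defs.
From HB Require Import structures.
From mathcomp Require Import all_boot all_order all_algebra.
From mathcomp Require Import all_classical reals topology.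
From mathcomp Require Import lra zify.

Import Order.TTheory GRing.Theory Num.Theory.
Import numFieldTopology.Exports.

Local Open Scope classical_set_scope.
Local Open Scope ring_scope.

(** The same [c] is the slack allowed above [e] and the gain obtained below it, so
    triangle-inequality errors smaller than [c] can be absorbed. *)
Definition gap_contraction (R : realType) (X : metricType R) (K : set X)
    (T f g : X -> X) : Prop :=
  forall e : R, 0 < e -> exists2 c : R, 0 < c &
    forall x y, K x -> K y ->
      mdist (f x) (g y) < e + c ->
      mdist (T x) (f x) < e + c ->
      mdist (T y) (g y) < e + c ->
      mdist (T x) (g y) + mdist (T y) (f x) < 2 * (e + c) ->
      mdist (T x) (T y) <= e - c.
Arguments gap_contraction {R X} K T f g.

Lemma gap_contraction_of_usc (R : realType) (X : metricType R) (K : set X)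
    (T f g : X -> X) (phi : R -> R) :
  upper_semicontinuous_on [set t : R | 0 <= t] phi ->
  (forall t, 0 < t -> 0 <= phi t < t) ->
  (forall x y, K x -> K y ->
      mdist (T x) (T y) <=
      phi (Num.min
        (Num.max (mdist (f x) (g y))
        (Num.max (mdist (T x) (f x))
        (Num.max (mdist (T y) (g y))
          (2^-1 * (mdist (T x) (g y) + mdist (T y) (f x))))))
        (Num.max (mdist (f y) (g x))
        (Num.max (mdist (T x) (g x))
        (Num.max (mdist (T y) (f y))
          (2^-1 * (mdist (T x) (f y) + mdist (T y) (g x)))))))) ->
  gap_contraction K T f g.
Proof.
move=> usc phi_lt contr e e0.
have /andP[phie0 phiee] := phi_lt e e0.
(* Semicontinuity at [e] keeps [phi] below this midpoint within radius [r]. With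
   [c = min r (e - a)], an argument in [(e - c, e + c)] falls in that ball and [a <= e - c]; a
   positive argument up to [e - c] is settled by [phi M < M]. *)
pose a := (phi e + e) / 2.
have phia : phi e < a by rewrite /a; lra.
have ae : a < e by rewrite /a; lra.
have a0 : 0 <= a by rewrite /a; lra.
have /nbhs_ballP[r /= r0 near_e] := usc e a (ltW e0) phia.
exists (Num.min r (e - a)); first by rewrite lt_min r0 subr_gt0.
set c := Num.min r (e - a) => x y Kx Ky fg Tf Tg Tgf.
have cr : c <= r by rewrite ge_min lexx.
have ca : c <= e - a by rewrite ge_min lexx orbT.
have := contr x y Kx Ky; set M := Num.min _ _ => dphi.
have Mec : M < e + c.
  by rewrite gt_min; apply/orP; left; rewrite !gt_max fg Tf Tg /=; lra.
have M0 : 0 <= M by rewrite le_min !le_max !mdist_ge0.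
have [Mpos|Mle0] := ltP 0 M; last first.
  (* phi 0 may be positive, so the contraction gives nothing when M = 0; but
     then one of the two maxima vanishes and forces T x = T y. *)
  suff : mdist (T x) (T y) <= 0 by lra.
  move: Mle0; rewrite ge_min !ge_max => /orP[] /and4P[h1 h2 h3 _].
  - have := metric_triangle (T x) (f x) (T y).
    have := metric_triangle (f x) (g y) (T y).
    by rewrite (metric_sym (g y)); lra.
  - have := metric_triangle (T x) (g x) (T y).
    have := metric_triangle (g x) (f y) (T y).
    by rewrite (metric_sym (g x) (f y)) (metric_sym (f y) (T y)); lra.
have /andP[_ phiM] := phi_lt M Mpos.
have [Mle|Mgt] := leP M (e - c); first lra.
have : phi M < a; last lra.
apply: near_e => //=; rewrite /ball /= ltr_norml; apply/andP; split; lra.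
Qed.

Lemma gap_contraction_swap (R : realType) (X : metricType R) (K : set X)
    (T f g : X -> X) :
  gap_contraction K T f g -> gap_contraction K T g f.
Proof.
move=> gap e /gap[c c0 step]; exists c => // x y Kx Ky gf Tg Tf s.
rewrite metric_sym; apply: step => //; first by rewrite metric_sym.
by rewrite addrC.
Qed.

(** If [T x] and [T y] differed, the gap at [e = mdist (T x) (T y)] would give [e <= e - c]. *)
Lemma gap_contraction_eq (R : realType) (X : metricType R) (K : set X)
    (T f g : X -> X) (x y : X) :
  gap_contraction K T f g -> K x -> K y ->
  mdist (f x) (g y) <= mdist (T x) (T y) ->
  mdist (T x) (f x) <= mdist (T x) (T y) ->
  mdist (T y) (g y) <= mdist (T x) (T y) ->
  mdist (T x) (g y) + mdist (T y) (f x) <= 2 * mdist (T x) (T y) ->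
  T x = T y.
Proof.
move=> gap Kx Ky fg Tf Tg s; apply: contrapT => /eqP neq.
have := neq; rewrite -mdist_gt0 => d0.
have [c c0 step] := gap _ d0.
suff : mdist (T x) (T y) <= mdist (T x) (T y) - c by lra.
by apply: step => //; lra.
Qed.

(** For [d = mdist (T u) (f u) > 0], the gap puts [T x] within [d - c] of [T u]; as [T x] is within
    [c / 2] of [f u], this gives [d < d - c / 2]. *)
Lemma gap_contraction_coincidence (R : realType) (X : metricType R)
    (K : set X) (T f g : X -> X) (u : X) :
  gap_contraction K T f g -> K u ->
  (forall e : R, 0 < e -> exists2 x, K x &
     mdist (f u) (g x) < e /\ mdist (f u) (T x) < e) ->
  T u = f u.
Proof.
move=> gap Ku approx; apply: contrapT => /eqP neq.
have := neq; rewrite -mdist_gt0 => d0.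
have [c c0 step] := gap _ d0.
set d := mdist (T u) (f u) in d0 step *.
have [|x Kx []] := approx (Num.min (c / 2) (d / 2)).
  by rewrite lt_min !divr_gt0.
rewrite !lt_min => /andP[gc gd] /andP[Tc Td].
have h1 := metric_triangle (T u) (f u) (g x).
have h2 := metric_triangle (T x) (f u) (g x).
have h3 := metric_triangle (T u) (T x) (f u).
have h4 : mdist (T x) (f u) = mdist (f u) (T x) by rewrite metric_sym.
rewrite -/d in h1 h3.
have : mdist (T u) (T x) <= d - c; last by lra.
by apply: step; rewrite -/d //; lra.
Qed.

Section alternating_sequence.
Context (R : realType) (X : metricType R) (y : nat -> X).
(** Here [y n.+1] stands for the image under [T] of a point that [f] or [g], according to the parity
    of [n], sends to [y n]. Opposite parities mean that one point is seen through [f] and the other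
    through [g]. *)
Hypothesis gap_seq : forall e : R, 0 < e -> exists2 c : R, 0 < c &
  forall n m, odd n (+) odd m ->
    mdist (y n) (y m) < e + c ->
    mdist (y n.+1) (y n) < e + c ->
    mdist (y m.+1) (y m) < e + c ->
    mdist (y n.+1) (y m) + mdist (y m.+1) (y n) < 2 * (e + c) ->
    mdist (y n.+1) (y m.+1) <= e - c.

Let d n := mdist (y n.+1) (y n).

Lemma alternating_step_le n : d n.+1 <= d n.
Proof.
rewrite leNgt; apply/negP => lt_d.
have d0 : 0 < d n.+1 by apply: le_lt_trans lt_d; exact: mdist_ge0.
have [c c0 step] := gap_seq _ d0.
suff : d n.+1 <= d n.+1 - c by lra.
have h := metric_triangle (y n.+2) (y n.+1) (y n).
rewrite -/(d n) -/(d n.+1) in h.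
by apply: step; rewrite ?mdistxx -/(d n) -/(d n.+1) /= ?addNb ?addbb //; lra.
Qed.

Lemma alternating_step_small (e : R) : 0 < e -> exists N, forall n,
  (N <= n)%N -> d n < e.
Proof.
move=> e0.
have anti n m : (n <= m)%N -> d m <= d n.
  elim: m => [|m IH]; first by rewrite leqn0 => /eqP ->.
  rewrite leq_eqVlt => /orP[/eqP -> //|]; rewrite ltnS => /IH.
  by apply: le_trans; exact: alternating_step_le.
suff [N dN] : exists N, d N < e.
  by exists N => n /anti /le_lt_trans; apply.
have lb0 : lbound (range d) 0 by move=> _ [n _ <-]; exact: mdist_ge0.
have hinf : has_inf (range d) by split; [exists (d 0%N), 0%N | exists 0].
pose r := inf (range d).
have rle n : r <= d n by apply: ge_inf; [exists 0 | exists n].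
have r_ge0 : 0 <= r by apply: lb_le_inf => //; exact: hinf.1.
(* Were the infimum [r] positive, a step below [r + c] would be followed by one at most [r - c]. *)
have r0 : r = 0.
  apply/eqP; rewrite eq_le r_ge0 andbT leNgt; apply/negP => rpos.
  have [c c0 step] := gap_seq _ rpos.
  have [_ [n _ <-] dn] := inf_adherent c0 hinf.
  rewrite -/r in dn.
  have dn1 := alternating_step_le n.
  have h := metric_triangle (y n.+2) (y n.+1) (y n).
  rewrite -/(d n) -/(d n.+1) in h.
  suff : d n.+1 <= r - c by have := rle n.+1; lra.
  by apply: step; rewrite ?mdistxx -/(d n) -/(d n.+1) /= ?addNb ?addbb //; lra.
have [_ [n _ <-] dn] := inf_adherent e0 hinf.
by exists n; rewrite -/r r0 add0r in dn.
Qed.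

Lemma alternating_opposite_small (e : R) : 0 < e -> exists N, forall n k,
  (N < n)%N -> mdist (y n) (y (n + k.*2.+1)) < e.
Proof.
move=> e0; have [c c0 step] := gap_seq _ e0.
have [|N small] := alternating_step_small (Num.min (c / 4) e).
  by rewrite lt_min e0 divr_gt0.
have smallc n : (N <= n)%N -> d n < c / 4.
  by move=> /small; rewrite lt_min => /andP[].
have smalle n : (N <= n)%N -> d n < e.
  by move=> /small; rewrite lt_min => /andP[].
(* The inequality [N < n] is strict because the induction applies the gap one index lower, to the
   pair [n], [m.+1]. Its distances exceed [e] by less than three steps of size [c / 4]. *)
exists N => -[//|n] k; rewrite ltnS => Nn.
elim: k => [|k IH].
  by rewrite addn1 metric_sym smalle // leqW.
set m := (n.+1 + k.*2.+1)%N in IH.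
have -> : (n.+1 + k.+1.*2.+1)%N = m.+2 by rewrite /m doubleS; lia.
have Nm : (N <= m)%N by rewrite /m; lia.
have Nm1 : (N <= m.+1)%N by apply: leqW.
have := smallc n Nn; have := smallc m Nm; have := smallc m.+1 Nm1.
rewrite /d => c1 c2 c3.
have h1 := metric_triangle (y n) (y n.+1) (y m.+1).
have h2 := metric_triangle (y n.+1) (y m) (y m.+1).
have h3 := metric_triangle (y m.+2) (y m.+1) (y n).
have h4 : mdist (y m) (y m.+1) = mdist (y m.+1) (y m) by rewrite metric_sym.
have h5 : mdist (y n) (y n.+1) = mdist (y n.+1) (y n) by rewrite metric_sym.
have h6 : mdist (y m.+1) (y n) = mdist (y n) (y m.+1) by rewrite metric_sym.
suff : mdist (y n.+1) (y m.+2) <= e - c by lra.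
apply: step; [|lra..].
by rewrite /m /= !oddD /= odd_double; case: (odd n).
Qed.

Lemma alternating_cauchy : cauchy (y @ \oo).
Proof.
apply/cauchy_ballP => e e0.
have e20 : 0 < e / 2 by rewrite divr_gt0.
have [N1 opp] := alternating_opposite_small _ e20.
have [N2 small] := alternating_step_small _ e20.
have main n m : (N1 + N2 < n)%N -> (n <= m)%N -> mdist (y n) (y m) < e.
  move=> Nn /subnKC <-.
  move: (m - n)%N => k; rewrite -(odd_double_half k).
  (* At an even distance, one extra step from [n + h.*2] to its successor reduces to opposite
     parities; hence the halves of [e]. *)
  move: k./2 => h; case: (odd k); rewrite ?add1n ?add0n.
    by apply: (lt_trans (opp _ _ _)); [lia|lra].
  have := opp n h ltac:(lia).
  have := small (n + h.*2)%N ltac:(lia); rewrite /d -addnS.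
  have := metric_triangle (y n) (y (n + h.*2.+1)%N) (y (n + h.*2)%N).
  lra.
pose B := y @` [set n | (N1 + N2 < n)%N].
have nB : (y @ \oo) B by exists (N1 + N2).+1 => // n /= Nn; exists n.
exists (B, B) => // -[_ _] [/= [n Nn <-] [m Nm <-]].
rewrite ballEmdist /=; have [nm|/ltnW mn] := leqP n m; first exact: main.
by rewrite metric_sym; exact: main.
Qed.

End alternating_sequence.

Theorem corollary3p2 (R : realType) (X : metricType R) (K : set X)
    (T f g : X -> X) (phi : R -> R)
    (K_nonempty : K !=set0)
    (T_self : set_fun K K T) (f_self : set_fun K K f) (g_self : set_fun K K g)
    (closure_sub : closure (T @` K) `<=` (f @` K) `&` (g @` K))
    (phi_fun : set_fun [set t | 0 <= t] [set t | 0 <= t] phi)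
    (phi_usc : upper_semicontinuous_on [set t : R | 0 <= t] phi)
    (phi_lt : forall t, 0 < t -> 0 <= phi t < t)
    (contraction : forall x y, K x -> K y ->
      mdist (T x) (T y) <=
      phi (Num.min
        (Num.max (mdist (f x) (g y))
        (Num.max (mdist (T x) (f x))
        (Num.max (mdist (T y) (g y))
          (2^-1 * (mdist (T x) (g y) + mdist (T y) (f x))))))
        (Num.max (mdist (f y) (g x))
        (Num.max (mdist (T x) (g x))
        (Num.max (mdist (T y) (f y))
          (2^-1 * (mdist (T x) (f y) + mdist (T y) (g x))))))))
    (one_complete : complete_subset (closure (T @` K)) \/
      complete_subset (f @` K) \/ complete_subset (g @` K))
    (compat_Tf : weakly_compatible K T f)
    (compat_Tg : weakly_compatible K T g) :
  exists z : X,
    fixed_points K T `&` fixed_points K f `&` fixed_points K g = [set z].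

Proof.
have gap := gap_contraction_of_usc _ _ K T f g phi phi_usc phi_lt contraction.
have gap' := gap_contraction_swap _ _ _ _ _ _ gap.
have TK_sub x : K x -> (f @` K) (T x) /\ (g @` K) (T x).
  by move=> Kx; apply/closure_sub/subset_closure; exists x.
(* Choice needs a total function, so points outside [K] get themselves as a dummy value. *)
have /choice[F FP] : forall x, exists w, K x -> K w /\ f w = T x.
  move=> x; have [Kx|?] := pselect (K x); last by exists x.
  by have [[w Kw fw] _] := TK_sub x Kx; exists w.
have /choice[G GP] : forall x, exists w, K x -> K w /\ g w = T x.
  move=> x; have [Kx|?] := pselect (K x); last by exists x.
  by have [_ [w Kw gw]] := TK_sub x Kx; exists w.
have [x0 Kx0] := K_nonempty.
pose xs := fix xs n :=
  if n is m.+1 then if odd m then G (xs m) else F (xs m) else x0.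
have Kxs n : K (xs n).
  by elim: n => //= n IH; case: (odd n); [have [] := GP _ IH|have [] := FP _ IH].
have fxs n : ~~ odd n -> f (xs n.+1) = T (xs n).
  by move=> /negbTE /= ->; have [] := FP _ (Kxs n).
have gxs n : odd n -> g (xs n.+1) = T (xs n).
  by move=> /= ->; have [] := GP _ (Kxs n).
pose y n := T (xs n).
have y_cauchy : cauchy (y @ \oo).
  apply: alternating_cauchy => e /gap[c c0 step]; exists c => // n m.
  (* The gap is applied to [xs n.+1] and [xs m.+1]. Since [f] must act on the successor of the even
     index, the two are exchanged when [n] is odd. *)
  case: (boolP (odd n)) => [on|en]; case: (boolP (odd m)) => [om|em] //= _.
    move=> d1 d2 d3 d4; rewrite metric_sym; apply: step => //.
    - by rewrite fxs // gxs // metric_sym.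
    - by rewrite fxs.
    - by rewrite gxs.
    - by rewrite fxs // gxs // addrC.
  by move=> d1 d2 d3 d4; apply: step; rewrite ?fxs ?gxs.
have [l ly] : exists l : X, y @ \oo --> l.
  case: one_complete => [|[]] compl.
  - have [|l _ ?] := compl y _ y_cauchy; last by exists l.
    by move=> n; apply/subset_closure; exists (xs n).
  - have [|l _ ?] := compl y _ y_cauchy; last by exists l.
    by move=> n; have [] := TK_sub _ (Kxs n).
  - have [|l _ ?] := compl y _ y_cauchy; last by exists l.
    by move=> n; have [] := TK_sub _ (Kxs n).
have y_near e : 0 < e -> exists N, forall n, (N <= n)%N -> mdist l (y n) < e.
  move=> e0; have [N _ yN] := ly _ (nbhsx_ballx l e e0).
  by exists N => n /yN; rewrite /= ballEmdist.
have /closure_sub[[u Ku fu] [v Kv gv]] : closure (T @` K) l.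
  move=> B /ly[N _ yN]; exists (y N); split; first by exists (xs N).
  exact: yN (leqnn N).
have Tu : T u = l.
  rewrite -fu; apply: gap_contraction_coincidence gap Ku _ => e /y_near[N yN].
  (* The predecessor index is odd, so [g] sends this point to [y N.*2.+1], which tends to [l = f u]
     like its image under [T]. *)
  exists (xs N.*2.+2) => //; rewrite fu gxs ?oddS ?odd_double //.
  by split; [apply: (yN N.*2.+1)|apply: (yN N.*2.+2)]; lia.
have Tv : T v = l.
  rewrite -gv; apply: gap_contraction_coincidence gap' Kv _ => e /y_near[N yN].
  exists (xs N.*2.+1) => //; rewrite gv fxs ?odd_double //.
  by split; [apply: (yN N.*2)|apply: (yN N.*2.+1)]; lia.
have Kl : K l by rewrite -fu; exact: f_self.
have fl : f l = T l.
  by have := compat_Tf u Ku; rewrite fu Tu; apply.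
have gl : g l = T l.
  by have := compat_Tg v Kv; rewrite gv Tv; apply.
have Tl : T l = l.
  (* Since [f l = T l] and [g v = T v = l], each distance in the maximum is 0 or [mdist (T l) l].
     The same collapse below gives uniqueness, for the pair [z], [l]. *)
  rewrite -[RHS]Tv; apply: gap_contraction_eq gap Kl Kv _ _ _ _;
    by rewrite ?fl ?gv Tv ?mdistxx ?mdist_ge0 // (metric_sym l); lra.
exists l; apply/seteqP; split => [z [[[Kz Tz] [_ fz]] [_ gz]]|_ ->] /=.
  rewrite -Tz -Tl; apply: gap_contraction_eq gap Kz Kl _ _ _ _;
    by rewrite ?fz ?gl ?Tz !Tl ?mdistxx ?mdist_ge0 // (metric_sym l); lra.
by split; [split|]; split => //; rewrite ?fl ?gl.
Qed.
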